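(* Let $H=\prod_p p^{a_p}<H'=\prod_p p^{b_p}$ be consecutive highly composite numbers with $L_-(H,H')=2$. Put $g=\gcd(H,H')$, $C=H'/g$, $\delta=d(g)/d(H)$. Let the two required deletion layers have prime bases $r,s$ (possibly $r=s$), so $H/g=rs$, and old exponent levels $j_r,j_s$. Consider an admissible deletion order $r\mid s$, meaning that the $r$-layer is deleted first and the $s$-layer second, and put $\alpha_r=\frac{j_r}{j_r+1}$. Then the optimal normalised capacity $\beta_{r\mid s}$ among $H'$-admissible geodesics from $H$ to $H'$ with this deletion order is $$\beta_{r\mid s}=\min\{\alpha_r,\ \delta\,R_s(C;g)\},\qquad R_s(C;g):=\max_{\substack{Q\mid C\\ Q\le C/s}}\frac{d(gQ)}{d(g)}.$$ If the two deletions lie in distinct prime coordinates ($r\ne s$), both orders are admissible and $$\beta^{\mathrm{geo}}(H,H')=\max\{\beta_{r\mid s},\beta_{s\mid r}\}.$$ If both deletions occur in one coordinate ($r=s$), only the order deleting the top layer first is admissible.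
   Context: $d(n)$ denotes the number of positive divisors of $n$. A positive integer $H$ is highly composite if $d(m)<d(H)$ for all integers $1\le m<H$. Two highly composite numbers $H<H'$ are consecutive if no highly composite number lies strictly between them. Put $L_-(H,H')=\sum_p\max(a_p-b_p,0)$. An exponent-lattice geodesic from $H$ to $H'$ is a sequence of positive integers starting at $H$ and ending at $H'$ in which each step changes the exponent of exactly one prime by one unit, always in the direction of its target exponent; increasing steps are insertions, decreasing steps deletions. It is $H'$-admissible if every vertex $z$ satisfies $z\le H'$. The normalised capacity of a geodesic $\gamma$ is $\frac1{d(H)}\min_{z\in\gamma}d(z)$ (over all vertices, endpoints included), and $\beta^{\mathrm{geo}}(H,H')$ is the maximum of this quantity over all $H'$-admissible geodesics from $H$ to $H'$. A required deletion layer with prime base $p$ and old exponent level $j$ is the move lowering the exponent of $p$ from $j$ to $j-1$, where $b_p<j\le a_p$. Thus if $r\ne s$ then $j_r=a_r$, $j_s=a_s$; if $r=s$, the two levels are $a_r$ and $a_r-1$ and the first deleted layer has level $a_r$. A deletion order is admissible if within one prime coordinate the higher level is deleted before the lower one. The set over which the maximum in $R_s(C;g)$ is taken always contains $Q=1$. *)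

(* Defs.v *)
From mathcomp Require Import all_boot all_order all_algebra.

Set Implicit Arguments.
Unset Strict Implicit.
Unset Printing Implicit Defensive.

Import Order.TTheory GRing.Theory Num.Theory.

Local Open Scope nat_scope.

Definition numdiv (n : nat) : nat := size (divisors n).

Definition highly_composite (H : nat) : Prop :=
  0 < H /\ forall m, 1 <= m < H -> numdiv m < numdiv H.

Definition consecutive_hc (H H' : nat) : Prop :=
  [/\ highly_composite H, highly_composite H', H < H'
    & forall K, highly_composite K -> ~ (H < K < H')].

(* Truncated subtraction is the positive part max(a_p - b_p, 0); primes p not
   dividing H contribute 0. *)
Definition Lminus (H H' : nat) : nat :=
  \sum_(p <- primes H) (logn p H - logn p H').

(* In both kinds of step, primality of the quotient forces x and y to be
   positive, so that the step changes the exponent of that prime only, by 1. *)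
Definition insertion_step (H' x y : nat) : bool :=
  let p := y %/ x in [&& x %| y, prime p & logn p x < logn p H'].

Definition deletion_step (H' x y : nat) : bool :=
  let p := x %/ y in [&& y %| x, prime p & logn p H' < logn p x].

Definition geo_step (H' x y : nat) : bool :=
  insertion_step H' x y || deletion_step H' x y.

(* The vertices of the geodesic are H :: w. *)
Definition geodesic (H H' : nat) (w : seq nat) : bool :=
  path (geo_step H') H w && (last H w == H').

Definition admissible_geodesic (H H' : nat) (w : seq nat) : bool :=
  geodesic H H' w && all (fun z => z <= H') (H :: w).

(* The default value numdiv H is attained at the vertex H, so this is the
   minimum over the vertices. *)
Definition capacity (H : nat) (w : seq nat) : rat :=
  ((\big[minn/numdiv H]_(z <- H :: w) numdiv z)%:R / (numdiv H)%:R)%R.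

(* A deletion layer is a pair (prime base, old exponent level); the levels of
   the required layers at p are those j with b_p < j <= a_p. *)
Definition required_layers (H H' : nat) : seq (nat * nat) :=
  [seq (p, j) | p <- primes H,
                j <- iota (logn p H').+1 (logn p H - logn p H')].

Definition deletion_order (H H' : nat) (o : seq (nat * nat)) : bool :=
  perm_eq o (required_layers H H').

Definition admissible_order (H H' : nat) (o : seq (nat * nat)) : bool :=
  deletion_order H H' o &&
  pairwise (fun l l' : nat * nat => (l.1 == l'.1) ==> (l'.2 < l.2)) o.

(* The layers deleted along the vertices H :: w, in order of deletion. *)
Definition deleted_layers (H H' : nat) (w : seq nat) : seq (nat * nat) :=
  [seq (e.1 %/ e.2, logn (e.1 %/ e.2) e.1)
     | e <- zip (H :: w) w & deletion_step H' e.1 e.2].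

Definition is_maximum (S : rat -> Prop) (m : rat) : Prop :=
  S m /\ forall x, S x -> (x <= m)%R.

Definition is_beta_geo (H H' : nat) (b : rat) : Prop :=
  is_maximum
    (fun c => exists2 w, admissible_geodesic H H' w & c = capacity H w) b.

Definition is_beta_order (H H' : nat) (o : seq (nat * nat)) (b : rat) : Prop :=
  is_maximum
    (fun c => exists2 w, admissible_geodesic H H' w /\ deleted_layers H H' w = o
                       & c = capacity H w) b.

Definition alpha (j : nat) : rat := (j%:R / j.+1%:R)%R.

Definition delta (H H' : nat) : rat :=
  ((numdiv (gcdn H H'))%:R / (numdiv H)%:R)%R.

(* The quotient C / s is rational: s need not divide C.  The terms are positive,
   so the default value 0 is irrelevant as soon as the range is nonempty, which
   holds when s <= C (take Q = 1). *)
Definition Rmax (s C g : nat) : rat :=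
  (\big[Num.max/0]_(Q <- divisors C | (Q%:R : rat) <= C%:R / s%:R)
     ((numdiv (g * Q)%N)%:R / (numdiv g)%:R))%R.

(* Main.v *)
(* No integer strictly between H and H' has more divisors than H, so an
   admissible geodesic cannot start with an insertion (it would reach a proper
   multiple of H below H'): its first step deletes r, and visits H/r, whose
   normalised divisor count is alpha.  The second deletion goes from gsQ <= H'
   to gQ with Q | C, which bounds the capacity by delta R_s.  Conversely, for a
   maximising Q, every vertex of the path H, H/r = gs, ..., gsQ, gQ, ..., H'
   is a multiple of H/r or of gQ, so both bounds are attained. *)
Require Import Defs.
From mathcomp Require Import all_boot all_order all_algebra.
From mathcomp Require Import zify.

Set Implicit Arguments.
Unset Strict Implicit.
Unset Printing Implicit Defensive.

Import Order.TTheory GRing.Theory Num.Theory.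

(** * Valuations and the divisor-counting function *)

Lemma dvdn_from_log m n :
  0 < m -> 0 < n -> (forall p, logn p m <= logn p n) -> m %| n.
Proof.
move=> m0 n0 le_mn; apply/gcdn_idPl/eqn_from_log => //; first by rewrite gcdn_gt0 m0.
by move=> p; rewrite logn_gcd //; apply/minn_idPl.
Qed.

Lemma lognMprime p q x : 0 < x -> prime p -> logn q (x * p) = logn q x + (q == p).
Proof. by move=> x0 pp; rewrite lognM ?(prime_gt0 pp) // (logn_prime _ pp). Qed.

Lemma numdiv_gt0 n : 0 < n -> 0 < numdiv n.
Proof.
by move=> n0; rewrite /numdiv; have := divisor1 n; case: (divisors n).
Qed.

Lemma numdiv_lt x y : 0 < y -> x %| y -> x < y -> numdiv x < numdiv y.
Proof.
move=> y0 xy lt_xy; have x0 := dvdn_gt0 y0 xy.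
apply: (@uniq_leq_size _ (y :: divisors x)) => [|z].
  by rewrite /= divisors_uniq andbT -dvdn_divisors //; apply/negP => /dvdn_leq; lia.
rewrite inE -!dvdn_divisors // => /orP[/eqP -> //|zx].
exact: dvdn_trans zx xy.
Qed.

Lemma numdiv_le x y : 0 < y -> x %| y -> numdiv x <= numdiv y.
Proof.
move=> y0 xy; have := dvdn_leq y0 xy; rewrite leq_eqVlt => /orP[/eqP -> //|lt_xy].
exact/ltnW/numdiv_lt.
Qed.

(** Unique factorisation makes [(i, d) |-> p ^ i * d] a bijection from pairs with [i <= k] and
    [d %| m] onto the divisors; reading off the exponent of [p] recovers [i], since coprimality
    keeps [p] out of [d]. *)
Lemma numdiv_pfactorM p k m :
  prime p -> coprime p m -> 0 < m -> numdiv (p ^ k * m) = k.+1 * numdiv m.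
Proof.
move=> pp cpm m0; have pk0 i : 0 < p ^ i by rewrite expn_gt0 prime_gt0.
have logd d : d %| m -> logn p d = 0.
  by move=> dm; apply/eqP; rewrite -leqn0 -(logn_coprime cpm) dvdn_leq_log.
rewrite /numdiv -(size_iota 0 k.+1) -(size_allpairs (fun i d => p ^ i * d)).
apply/perm_size/uniq_perm; first exact: divisors_uniq.
  apply: allpairs_uniq; [exact: iota_uniq | exact: divisors_uniq|].
  move=> [a b] [a' b'] /allpairsP[[i d] [_ dm [-> ->]]] /allpairsP[[i' d'] [_ dm' [-> ->]]] /= eq_id.
  rewrite /= -!dvdn_divisors // in dm dm'.
  have eq_i : i = i'.
    move: (congr1 (logn p) eq_id); rewrite !lognM ?(dvdn_gt0 m0 dm) ?(dvdn_gt0 m0 dm') ?pk0 //.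
    by rewrite !pfactorK // !logd // !addn0.
  by move: eq_id; rewrite eq_i => /eqP; rewrite eqn_pmul2l // => /eqP ->.
move=> x; rewrite -dvdn_divisors ?muln_gt0 ?pk0 //.
apply/idP/allpairsP => [xm|[[i d] []]]; last first.
  by rewrite mem_iota -dvdn_divisors // => /= ik dm ->; rewrite dvdn_mul // dvdn_exp2l //; lia.
have x0 : 0 < x by apply: dvdn_gt0 xm; rewrite muln_gt0 pk0.
have [x' cpx' def_x] := pfactor_coprime pp x0.
exists (logn p x, x'); split; last by rewrite /= mulnC.
  have := dvdn_leq_log p _ xm; rewrite muln_gt0 pk0 m0 => /(_ isT).
  by rewrite lognM ?pk0 // pfactorK // (logd m) // addn0 mem_iota.
rewrite -dvdn_divisors //= -(@Gauss_dvdr _ (p ^ k)); last by rewrite coprimeXr // coprime_sym.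
by apply: dvdn_trans xm; rewrite [X in _ %| X]def_x dvdn_mulr.
Qed.

(** One more factor [p] changes the divisor count by the ratio (e+2)/(e+1), where e is the exponent
    of [p] in [n]. The cross-multiplied form stays in [nat]; it is the source of [alpha]. *)
Lemma numdivMprime p n :
  prime p -> 0 < n -> numdiv (n * p) * (logn p n).+1 = (logn p n).+2 * numdiv n.
Proof.
move=> pp n0; have [m cpm def_n] := pfactor_coprime pp n0.
have m0 : 0 < m by case: (m) def_n n0 => [->|].
have def_n' : n = p ^ logn p n * m by rewrite mulnC.
have -> : numdiv (n * p) = (logn p n).+2 * numdiv m.
  by rewrite -(numdiv_pfactorM _ pp cpm m0) expnS -mulnA -def_n' mulnC.
by rewrite [in numdiv n]def_n' numdiv_pfactorM //; lia.
Qed.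

(* The least n > H with more divisors than H is itself highly composite. *)
Lemma numdiv_between H H' n : consecutive_hc H H' -> H < n < H' -> numdiv n <= numdiv H.
Proof.
move=> [[H0 hcH] _ _ gap] /andP[Hn nH']; rewrite leqNgt; apply/negP => lt_d.
have ex : exists m, (H < m) && (numdiv H < numdiv m) by exists n; rewrite Hn.
case: (ex_minnP ex) => m /andP[Hm dm] min_m.
have le_mn : m <= n by apply: min_m; rewrite Hn.
apply: (gap m); last by rewrite Hm (leq_ltn_trans le_mn).
split=> [|k /andP[k0 km]]; first exact: leq_ltn_trans Hm.
apply: leq_ltn_trans dm; case: (ltngtP k H) => [kH|Hk|-> //].
  by apply/ltnW/hcH; rewrite k0.
by rewrite leqNgt; apply/negP => dk; have := min_m k; rewrite Hk dk => /(_ isT); lia.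
Qed.

(** * Steps of a geodesic and the layers they delete *)

Lemma insertion_stepP H' x y :
  reflect (exists p, [/\ prime p, 0 < x, y = x * p & logn p x < logn p H'])
          (insertion_step H' x y).
Proof.
apply: (iffP and3P) => [[xy pp lt_log]|[p [pp x0 -> lt_log]]].
  exists (y %/ x); split=> //; last by rewrite mulnC divnK.
  by case: x {xy lt_log} pp => //; rewrite divn0.
by rewrite mulKn // dvdn_mulr.
Qed.

Lemma deletion_stepP H' x y :
  reflect (exists p, [/\ prime p, 0 < y, x = y * p & logn p H' < logn p x])
          (deletion_step H' x y).
Proof.
apply: (iffP and3P) => [[xy pp lt_log]|[p [pp x0 -> lt_log]]].
  exists (x %/ y); split=> //; last by rewrite mulnC divnK.
  by case: y {xy lt_log} pp => //; rewrite divn0.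
by rewrite mulKn // dvdn_mulr.
Qed.

Lemma insertion_not_deletion H' x y : insertion_step H' x y -> deletion_step H' x y = false.
Proof.
move=> /insertion_stepP[p [pp x0 -> _]]; apply/negP => /deletion_stepP[q [pq _ eq_x _]].
move/eqP: eq_x; rewrite -mulnA -{1}[x]muln1 eqn_pmul2l // eq_sym muln_eq1.
by have := prime_gt1 pp; case: eqP => // ->.
Qed.

Lemma mem_required_layers H H' p j :
  ((p, j) \in required_layers H H') = (logn p H' < j <= logn p H).
Proof.
apply/allpairsPdep/idP => [[q [i [_]]]|/andP[lt_j le_j]].
  by rewrite mem_iota => lt_i [-> ->]; lia.
by exists p, j; split=> //; [rewrite -logn_gt0; lia | rewrite mem_iota; lia].
Qed.

Lemma required_layers_uniq H H' : uniq (required_layers H H').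
Proof.
apply: allpairs_uniq_dep; [exact: primes_uniq | by move=> *; exact: iota_uniq|].
by move=> [p j] [q i] _ _ /= [-> ->].
Qed.

Lemma deleted_layers_cons x H' y w :
  deleted_layers x H' (y :: w) =
  (if deletion_step H' x y then [:: (x %/ y, logn (x %/ y) x)] else [::])
    ++ deleted_layers y H' w.
Proof. by rewrite /deleted_layers /=; case: ifP. Qed.

Lemma deleted_layers_insertions x H' w1 w2 :
  path (insertion_step H') x w1 ->
  deleted_layers x H' (w1 ++ w2) = deleted_layers (last x w1) H' w2.
Proof.
elim: w1 x => //= y w1 IH x /andP[st pw].
by rewrite deleted_layers_cons insertion_not_deletion // IH.
Qed.

(** An insertion at [p] happens below the target exponent, where [p] has no required layer before or
    after; a deletion at [p] removes exactly the top required layer at [p]. At the endpoint [H'] no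
    layer remains. *)
Lemma deleted_layers_required x H' w :
  path (geo_step H') x w -> last x w = H' ->
  perm_eq (deleted_layers x H' w) (required_layers x H').
Proof.
elim: w x => [|y w IH] x /=.
  move=> _ ->; rewrite perm_sym; apply/uniq_perm => [||[p j]] //.
    exact: required_layers_uniq.
  by rewrite mem_required_layers in_nil; lia.
move=> /andP[/orP st pw] lw; rewrite deleted_layers_cons; have {IH} := IH _ pw lw.
case: st => [ins|del].
  rewrite insertion_not_deletion // => /permPl ->; apply: uniq_perm; rewrite ?required_layers_uniq //.
  move=> [q j]; rewrite !mem_required_layers.
  case/insertion_stepP: ins => p [pp x0 -> lt_p]; rewrite lognMprime //.
  by case: eqP => [->|_]; lia.
rewrite del /= -(perm_cons (x %/ y, logn (x %/ y) x)) => /permPl ->.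
case/deletion_stepP: del => p [pp y0 -> lt_p]; rewrite mulKn // in lt_p *.
apply: uniq_perm; rewrite /= ?required_layers_uniq ?andbT //.
  by rewrite mem_required_layers lognMprime // eqxx; lia.
move: lt_p; rewrite !lognMprime // eqxx => lt_p.
move=> [q j]; rewrite inE !mem_required_layers lognMprime // xpair_eqE.
by case: eqP => [->|_] /=; lia.
Qed.

(** Exponents move only towards their targets: a deletion starts strictly above the exponent in
    [H'], so it ends no lower than that exponent, which already bounds the one in [g]. *)
Lemma dvdn_geo_step g H' x y :
  0 < H' -> g %| H' -> g %| x -> geo_step H' x y -> g %| y.
Proof.
move=> H'0 gH' gx /orP[/insertion_stepP[p [_ _ -> _]]|]; first exact: dvdn_mulr.
case/deletion_stepP=> p [pp y0 def_x lt_p].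
have x0 : 0 < x by rewrite def_x muln_gt0 y0 prime_gt0.
apply: dvdn_from_log => //; first exact: dvdn_gt0 gH'.
move=> q; have := dvdn_leq_log q x0 gx; have := dvdn_leq_log q H'0 gH'.
move: lt_p; rewrite def_x !lognMprime // eqxx; case: eqP => [->|_]; lia.
Qed.

Lemma geo_step_gt0 H' x y : geo_step H' x y -> 0 < y.
Proof.
case/orP=> [/insertion_stepP[p [pp x0 -> _]]|/deletion_stepP[p [_ ? _ _]] //].
by rewrite muln_gt0 x0 prime_gt0.
Qed.

(** Take for [z] the vertex just after the only remaining deletion. No required layer is left there,
    so no exponent exceeds its target and [z] divides [H']; the vertex just before is [z * p], which
    obeys the size bound. *)
Lemma last_deletion g H' x w p j :
  0 < H' -> g %| H' -> g %| x -> path (geo_step H') x w -> last x w = H' ->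
  all (fun z => z <= H') (x :: w) -> deleted_layers x H' w = [:: (p, j)] ->
  exists2 z, z \in w & [/\ g %| z, z %| H' & z * p <= H'].
Proof.
move=> H'0 gH'; elim: w x => [|y w IH] x gx; first by [].
rewrite deleted_layers_cons [path _ _ _]/= [last _ _]/= => /andP[st pw] lw /andP[le_x all_w].
have gy := dvdn_geo_step H'0 gH' gx st.
case: ifP => [del [def_p _ eq0]|_ /= dl]; last first.
  by have [z zw Pz] := IH y gy pw lw all_w dl; exists z => //; rewrite inE zw orbT.
exists y; first exact: mem_head.
split=> //; last first.
  by move: del => /and3P[yx _ _]; rewrite -def_p mulnC divnK.
have y0 := geo_step_gt0 st; apply: dvdn_from_log => // q.
have := deleted_layers_required pw lw; rewrite eq0 perm_sym => /perm_nilP eq_rl.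
have := mem_required_layers y H' q (logn q y); rewrite eq_rl in_nil; lia.
Qed.

(** The prime factors of [m] are inserted one at a time. The exponent condition is limited to primes
    of [m] because [x] may still carry an excess elsewhere, as [g * s] does at [s]. Sandwiching
    every vertex between [x] and [x * m] for divisibility bounds both its size and its divisor
    count. *)
Lemma insertion_path H' x m :
  0 < x -> 0 < m -> {in primes m, forall p, logn p (x * m) <= logn p H'} ->
  exists w, [/\ path (insertion_step H') x w, last x w = x * m
    & {in x :: w, forall z, x %| z /\ z %| x * m}].
Proof.
elim: m {-2}m (leqnn m) x => [|n IH] m le_mn x x0 m0 le_log; first by lia.
have [|m1|m1] := ltngtP m 1; [by lia| |]; last first.
  by exists [::]; rewrite m1 muln1; split=> // z; rewrite inE => /eqP ->.
have pp := pdiv_prime m1.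
have def_m := divnK (pdiv_dvd m); set p := pdiv m in pp def_m *; set m' := m %/ p in def_m *.
have p1 := prime_gt1 pp.
have m'0 : 0 < m' by rewrite /m' divn_gt0 ?prime_gt0 // dvdn_leq // pdiv_dvd.
have eq_xm : x * p * m' = x * m by rewrite -def_m [m' * p]mulnC mulnA.
have [||||w [pw lw Pw]] := IH m' _ (x * p); rewrite ?muln_gt0 ?x0 ?(prime_gt0 pp) //; first by nia.
  move=> q q_m'; rewrite eq_xm; apply: le_log.
  by rewrite -def_m primesM ?(prime_gt0 pp) // q_m'.
exists (x * p :: w); split.
- rewrite /= pw andbT; apply/insertion_stepP; exists p; split=> //.
  (* The factor [p] of [m] raises the exponent strictly above that of [x], which gives the strict
     inequality an insertion needs. *)
  apply: leq_trans (le_log p _); last by rewrite mem_primes pp m0 pdiv_dvd.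
  by rewrite -eq_xm lognM ?muln_gt0 ?x0 ?(prime_gt0 pp) // lognMprime // eqxx; lia.
- by rewrite /= lw.
- rewrite eq_xm in Pw.
  move=> z; rewrite inE => /orP[/eqP ->|/Pw[xz zx]]; first by rewrite dvdnn dvdn_mulr.
  by split=> //; apply: dvdn_trans xz; rewrite dvdn_mulr.
Qed.

Lemma perm_eq2 (T : eqType) (x y : T) (o : seq T) :
  perm_eq o [:: x; y] -> o = [:: x; y] \/ o = [:: y; x].
Proof.
move=> po; have := perm_size po; case: o po => [|a [|b []]] //= po _.
have := perm_mem po a; rewrite !inE eqxx /= => /esym/orP[] /eqP eq_a; subst a.
  by move: po; rewrite perm_cons => /perm_small_eq -> //; left.
have pxy : perm_eq [:: x; y] [:: y; x] by rewrite (perm_catC [:: x] [:: y]).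
by move: po; rewrite (permPr pxy) perm_cons => /perm_small_eq -> //; right.
Qed.

(** This turns the list of layers into exponent differences, from which the quotient of [H] by the
    gcd is recovered prime by prime. *)
Lemma logn_count_layers H H' p :
  count (fun l => l.1 == p) (required_layers H H') = logn p H - logn p H'.
Proof.
rewrite -size_filter -(size_iota (logn p H').+1 (_ - _)) -(size_map (pair p) (iota _ _)).
apply/perm_size/uniq_perm.
- exact/filter_uniq/required_layers_uniq.
- by rewrite map_inj_uniq ?iota_uniq // => i j [].
move=> [q j]; rewrite mem_filter /= mem_required_layers; apply/andP/mapP.
  by case=> /eqP -> lt_j; exists j; rewrite // mem_iota; lia.
by case=> i; rewrite mem_iota => lt_i [-> ->]; rewrite eqxx; split=> //; lia.
Qed.

Local Open Scope ring_scope.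

(** * Capacities and the three ratios as rational numbers *)

Lemma capacity_le H w z :
  z \in H :: w -> capacity H w <= (numdiv z)%:R / (numdiv H)%:R.
Proof.
move=> zw; rewrite ler_wpM2r ?invr_ge0 ?ler0n // ler_nat.
elim: (H :: w) zw => //= y s IH; rewrite inE big_cons => /orP[/eqP <-|/IH].
  exact: geq_minl.
exact/leq_trans/geq_minr.
Qed.

Lemma capacity_ge H w c :
  {in H :: w, forall z, c <= (numdiv z)%:R / (numdiv H)%:R} -> c <= capacity H w.
Proof.
move=> le_c; rewrite /capacity big_seq.
(* The default of the fold is the divisor count of the vertex [H], so the hypothesis also covers the
   base case. *)
elim/big_rec: _ => [|z n zw le_n]; first by apply: le_c; exact: mem_head.
by rewrite /minn; case: ifP => _ //; apply: le_c.
Qed.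

Lemma Rmax_ge s C g Q :
  (0 < C)%N -> (0 < s)%N -> (Q %| C)%N -> (Q * s <= C)%N ->
  (numdiv (g * Q)%N)%:R / (numdiv g)%:R <= Rmax s C g.
Proof.
move=> C0 s0 QC le_Q.
rewrite /Rmax; apply: bigmax_sup_seq (lexx _).
  by rewrite -dvdn_divisors.
by rewrite ler_pdivlMr ?ltr0n // -natrM ler_nat.
Qed.

(** Since [s <= C], the choice [Q = 1] is eligible and makes the maximum positive. Carrying this
    positivity through the fold rules out the default 0, so some eligible [Q] realises the value. *)
Lemma Rmax_attained s C g :
  (0 < C)%N -> (0 < s)%N -> (0 < g)%N -> (s <= C)%N ->
  exists Q, [/\ (Q %| C)%N, (Q * s <= C)%N
    & Rmax s C g = (numdiv (g * Q)%N)%:R / (numdiv g)%:R].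
Proof.
move=> C0 s0 g0 sC.
have cond Q : ((Q%:R : rat) <= C%:R / s%:R) = (Q * s <= C)%N.
  by rewrite ler_pdivlMr ?ltr0n // -natrM ler_nat.
have : 0 < Rmax s C g.
  apply: lt_le_trans (Rmax_ge g C0 s0 (dvd1n C) _); last by rewrite mul1n.
  by rewrite divr_gt0 // ltr0n numdiv_gt0 // muln1.
rewrite /Rmax big_seq_cond; elim/big_rec: _ => [|Q m /andP[QC]]; first by rewrite ltxx.
rewrite cond => le_Q IH; rewrite /Num.max; case: ifP => _; first exact: IH.
by exists Q; rewrite dvdn_divisors.
Qed.

Lemma delta_ratio H H' Q : (0 < H)%N ->
  delta H H' * ((numdiv (gcdn H H' * Q)%N)%:R / (numdiv (gcdn H H'))%:R) =
  (numdiv (gcdn H H' * Q)%N)%:R / (numdiv H)%:R.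
Proof.
move=> H0; rewrite /delta mulrC mulrA divfK // pnatr_eq0 -lt0n numdiv_gt0 //.
by rewrite gcdn_gt0 H0.
Qed.

Lemma alpha_ratio p n : prime p -> (0 < n)%N ->
  (numdiv n)%:R / (numdiv (n * p)%N)%:R = alpha (logn p (n * p)).
Proof.
move=> pp n0; rewrite /alpha lognMprime // eqxx addn1.
have np0 : (0 < n * p)%N by rewrite muln_gt0 n0 prime_gt0.
apply/eqP; rewrite eqr_div ?pnatr_eq0 -?lt0n ?numdiv_gt0 //.
by rewrite -!natrM mulnC -numdivMprime // mulnC.
Qed.

(** * Upper and lower bounds for a fixed deletion order *)

Lemma beta_order_upper H H' r jr s js w :
  consecutive_hc H H' -> ~~ (H %| H')%N -> prime s ->
  admissible_geodesic H H' w ->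
  deleted_layers H H' w = [:: (r, jr); (s, js)] ->
  capacity H w <=
    Num.min (alpha jr) (delta H H' * Rmax s (H' %/ gcdn H H') (gcdn H H')).
Proof.
move=> hc ndvd ps /andP[/andP[]].
have [[H0 _] _ HH' _] := hc; have H'0 := ltn_trans H0 HH'.
case: w => [|y w] //=; rewrite deleted_layers_cons => /andP[/orP st pw] /eqP lw all_w.
have [le_y all_w'] : (y <= H')%N /\ all (fun z => (z <= H')%N) w.
  by case/and3P: all_w.
(* Inserting first would give a multiple of H in ]H, H'] with more divisors. *)
have del : deletion_step H' H y.
  case: st => // /insertion_stepP[p [pp _ def_y _]].
  have Hy : (H < y)%N by rewrite def_y ltn_Pmulr // prime_gt1.
  have dvd_y : (H %| y)%N by rewrite def_y dvdn_mulr.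
  have y0 := ltn_trans H0 Hy; move: le_y; rewrite leq_eqVlt => /orP[/eqP eq_y|lt_y].
    by rewrite eq_y (negPf ndvd) in dvd_y.
  have := numdiv_between hc (n := y); rewrite Hy lt_y => /(_ isT).
  by rewrite leqNgt numdiv_lt.
rewrite del /= => -[def_r def_jr dl].
have gH' := dvdn_gcdr H H'; have g0 : (0 < gcdn H H')%N by rewrite gcdn_gt0 H0.
have gy : (gcdn H H' %| y)%N.
  by apply: (dvdn_geo_step H'0 gH' (dvdn_gcdl H H')); rewrite /geo_step del orbT.
case/deletion_stepP: del => p [pp y0 def_H _].
have eq_p : p = r by rewrite -def_r def_H mulKn.
rewrite le_min; apply/andP; split.
  apply: le_trans (@capacity_le _ _ y _) _; first by rewrite !inE eqxx orbT.
  by rewrite -def_jr def_r def_H -eq_p alpha_ratio.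
have all_yw : all (fun z => (z <= H')%N) (y :: w) by rewrite /= le_y.
have [z zw [gz zH' le_zs]] := last_deletion H'0 gH' gy pw lw all_yw dl.
apply: le_trans (@capacity_le _ _ z _) _; first by rewrite !inE zw !orbT.
(* The competitor in [Rmax] is [Q = z %/ g] with g the gcd: [z %| H'] becomes [Q %| C], and
   [z * s <= H'] becomes [Q * s <= C]. *)
rewrite -{1}(divnK gz) mulnC -delta_ratio // ler_wpM2l ?divr_ge0 ?ler0n //.
apply: Rmax_ge; rewrite ?(prime_gt0 ps) //.
  by rewrite divn_gt0 // dvdn_leq.
  by rewrite dvdn_divRL // divnK.
by rewrite leq_divRL // mulnAC divnK.
Qed.

(** The first layer is the top one at [r], so its level is written as an exponent of [H]. The level
    [js] is tied down only by the permutation hypothesis, which covers [r = s] and [r <> s]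
    alike. *)
Lemma beta_order_lower H H' r s js :
  (0 < H)%N -> (H < H')%N -> H = (gcdn H H' * s * r)%N -> prime r -> prime s ->
  (logn r H' < logn r H)%N -> (logn s H' < logn s H)%N ->
  perm_eq [:: (r, logn r H); (s, js)] (required_layers H H') ->
  exists2 w, admissible_geodesic H H' w /\
             deleted_layers H H' w = [:: (r, logn r H); (s, js)]
    & Num.min (alpha (logn r H)) (delta H H' * Rmax s (H' %/ gcdn H H') (gcdn H H'))
        <= capacity H w.
Proof.
move=> H0 HH' def_H pr ps lt_r lt_s layers.
have H'0 := ltn_trans H0 HH'; have g0 : (0 < gcdn H H')%N by rewrite gcdn_gt0 H0.
have log_g p := logn_gcd p H0 H'0.
have gH' := dvdn_gcdr H H'; set g := gcdn H H' in def_H g0 log_g gH' *.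
have s0 := prime_gt0 ps; have r0 := prime_gt0 pr.
set C := (H' %/ g)%N; have def_H' : H' = (g * C)%N by rewrite mulnC divnK.
have C0 : (0 < C)%N by rewrite divn_gt0 // dvdn_leq.
have gs0 : (0 < g * s)%N by rewrite muln_gt0 g0.
(* From [g * s <= H < H']; this makes [Q = 1] eligible. *)
have sC : (s <= C)%N.
  rewrite -(leq_pmul2l g0) -def_H' (leq_trans _ (ltnW HH')) // def_H.
  by rewrite leq_pmulr.
have [Q [QC le_Qs ->]] := Rmax_attained C0 s0 g0 sC.
have Q0 := dvdn_gt0 C0 QC.
have gQ0 : (0 < g * Q)%N by rewrite muln_gt0 g0.
have le_gQs : (g * s * Q <= H')%N by rewrite def_H' -mulnA leq_pmul2l // mulnC.
have gQH' : (g * Q %| H')%N by rewrite def_H' dvdn_pmul2l.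
have [|w1 [pw1 lw1 Pw1]] := insertion_path (H' := H') gs0 Q0.
  (* A prime dividing [Q] divides [C], so its exponent is smaller in [H] than in [H'] and it is
     neither [r] nor [s]. Its exponent in [g * s * Q] is therefore that in [g * Q], a divisor of
     [H']. *)
  move=> p; rewrite -logn_gt0 => lt_Q; rewrite lognM //.
  have := dvdn_leq_log p C0 QC.
  have := congr1 (logn p) def_H'; have := congr1 (logn p) def_H.
  rewrite lognMprime // !lognM // log_g; lia.
have CQ0 : (0 < C %/ Q)%N by rewrite divn_gt0 // dvdn_leq.
have eq_gC : (g * Q * (C %/ Q))%N = H' by rewrite -mulnA [(Q * _)%N]mulnC divnK.
have [|w2 [pw2 lw2 Pw2]] := insertion_path (H' := H') gQ0 CQ0.
  by move=> p _; rewrite eq_gC.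
have del1 : deletion_step H' H (g * s)%N by apply/deletion_stepP; exists r.
(* By [lt_s], [g] has the full target exponent at [s], so the extra factor [s] exceeds the
   target. *)
have del2 : deletion_step H' (g * s * Q)%N (g * Q)%N.
  apply/deletion_stepP; exists s; split=> //; first by rewrite mulnAC.
  by rewrite mulnAC lognMprime // eqxx lognM // log_g; lia.
have div1 : (H %/ (g * s))%N = r by rewrite def_H mulKn.
have div2 : ((g * s * Q) %/ (g * Q))%N = s by rewrite mulnAC mulKn.
have sub_geo : subrel (insertion_step H') (geo_step H') by move=> x y; rewrite /geo_step => ->.
have geo : path (geo_step H') H ((g * s)%N :: w1 ++ (g * Q)%N :: w2).
  rewrite /= cat_path /= lw1 (sub_path sub_geo pw1) (sub_path sub_geo pw2).
  by rewrite /geo_step del1 del2 !orbT.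
have last_w : last H ((g * s)%N :: w1 ++ (g * Q)%N :: w2) = H'.
  by rewrite /= last_cat /= lw2 eq_gC.
exists ((g * s)%N :: w1 ++ (g * Q)%N :: w2).
  split.
    apply/andP; split; first by rewrite /geodesic geo last_w eqxx.
    apply/allP=> z; rewrite inE -cat_cons mem_cat => /or3P[/eqP ->|/Pw1[_ zx]|/Pw2[_ zx]].
    - exact: ltnW.
    - by apply: leq_trans le_gQs; rewrite dvdn_leq // muln_gt0 gs0.
    - by rewrite eq_gC in zx; rewrite dvdn_leq.
  have := deleted_layers_required geo last_w.
  rewrite deleted_layers_cons del1 deleted_layers_insertions // lw1.
  rewrite deleted_layers_cons del2 -[w2]cats0 deleted_layers_insertions //.
  (* The level of the second deletion is not computed: cancelling the common first layer from the
     permutation forces it to be [js]. *)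
  rewrite div1 div2 /= -(permPr layers) perm_cons.
  by move/perm_small_eq => ->.
have le_alpha z : (0 < z)%N -> (g * s %| z)%N ->
    alpha (logn r H) <= (numdiv z)%:R / (numdiv H)%:R.
  move=> z0 gsz; rewrite {1}def_H -alpha_ratio // -def_H.
  by rewrite ler_wpM2r ?invr_ge0 ?ler0n // ler_nat numdiv_le.
(* The vertices fall into [H], the stretch from [g * s] to [g * s * Q], and the stretch from [g * Q]
   to [H']. The first two satisfy the [alpha] bound and the third the [Rmax] bound; either one
   suffices for the minimum. *)
apply: capacity_ge => z; rewrite inE -cat_cons mem_cat ge_min delta_ratio //.
case/or3P=> [/eqP ->|/Pw1[xz zx]|/Pw2[xz zx]].
- by rewrite le_alpha // def_H dvdn_mulr.
- by rewrite le_alpha // (dvdn_gt0 _ zx) // muln_gt0 gs0.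
- rewrite eq_gC in zx.
  by rewrite ler_wpM2r ?orbT ?invr_ge0 ?ler0n // ler_nat numdiv_le // (dvdn_gt0 H'0 zx).
Qed.

Local Close Scope ring_scope.

(** * Assembly: the quotient, each order, both orders together, and the one-coordinate case *)

Theorem theorem5p4 (H H' r jr s js : nat)
  (hcons : consecutive_hc H H')
  (hL : Lminus H H' = 2)
  (hlayers : perm_eq [:: (r, jr); (s, js)] (required_layers H H')) :
  let g := gcdn H H' in
  let C := H' %/ g in
  [/\ H %/ g = r * s,
      admissible_order H H' [:: (r, jr); (s, js)] ->
        is_beta_order H H' [:: (r, jr); (s, js)]
          (Num.min (alpha jr) (delta H H' * Rmax s C g)%R),
      r <> s ->
        [/\ admissible_order H H' [:: (r, jr); (s, js)],
            admissible_order H H' [:: (s, js); (r, jr)]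
          & forall brs bsr : rat,
              is_beta_order H H' [:: (r, jr); (s, js)] brs ->
              is_beta_order H H' [:: (s, js); (r, jr)] bsr ->
              is_beta_geo H H' (Num.max brs bsr)]
    & r = s ->
        forall o : seq (nat * nat),
          admissible_order H H' o <->
          o = [:: (r, logn r H); (r, (logn r H).-1)]].
Proof.
move=> g C; have [[H0 _] _ HH' _] := hcons; have H'0 := ltn_trans H0 HH'.
have in_layers p j : logn p H' < j <= logn p H = ((p, j) \in [:: (r, jr); (s, js)]).
  by rewrite (perm_mem hlayers) mem_required_layers.
have lt_r : logn r H' < jr <= logn r H by rewrite in_layers mem_head.
have lt_s : logn s H' < js <= logn s H by rewrite in_layers !inE eqxx orbT.
have pr : prime r by have := logn_gt0 r H; rewrite mem_primes; case: prime => //=; lia.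
have ps : prime s by have := logn_gt0 s H; rewrite mem_primes; case: prime => //=; lia.
have ndvd : ~~ (H %| H') by apply/negP => /(dvdn_leq_log r H'0); lia.
have gH : g %| H := dvdn_gcdl H H'.
have g0 : 0 < g by rewrite gcdn_gt0 H0.
(* The truncated difference is also the exponent of [p] in [H %/ g], whence the factorisation
   [r * s]. *)
have count_layers p : logn p H - logn p H' = (r == p) + (s == p).
  by rewrite -logn_count_layers -(permP hlayers) /= addn0.
have quo : H %/ g = r * s.
  apply: eqn_from_log; first by rewrite divn_gt0 // dvdn_leq.
    by rewrite muln_gt0 !prime_gt0.
  move=> p; rewrite logn_div // logn_gcd // lognMprime ?(prime_gt0 pr) // (logn_prime _ pr).
  by have := count_layers p; rewrite (eq_sym p r) (eq_sym p s); lia.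
have hlayers' : perm_eq [:: (s, js); (r, jr)] (required_layers H H').
  by rewrite -(permPr hlayers) (perm_catC [:: (s, js)] [:: (r, jr)]).
split=> //.
- case/andP=> _ /= /andP[/andP[/implyP/= top _] _].
  (* The top layer at [r] is required, hence one of the two listed. Were it the second, then [r = s]
     and admissibility would put [jr] above the exponent of [r] in [H]. *)
  have def_jr : jr = logn r H.
    have : (r, logn r H) \in [:: (r, jr); (s, js)] by rewrite -in_layers; lia.
    rewrite !inE !xpair_eqE eqxx /= => /orP[/eqP //|/andP[eq_rs]].
    by have := top eq_rs; move: lt_r; rewrite (eqP eq_rs); lia.
  have upper w := @beta_order_upper H H' r jr s js w hcons ndvd ps.
  have [||||w [adm dl] le_w] := @beta_order_lower H H' r s js H0 HH' _ pr ps.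
  + by rewrite -mulnA [s * r]mulnC -quo mulnC divnK.
  + lia.
  + lia.
  + by rewrite -def_jr.
  rewrite -def_jr in dl le_w; split=> [|_ [u [adm_u dl_u] ->]]; last exact: upper.
  by exists w => //; apply/eqP; rewrite eq_le le_w upper.
- move=> /eqP neq_rs; have neq_sr : s != r by rewrite eq_sym.
  split; rewrite /admissible_order /deletion_order ?hlayers ?hlayers' /= ?(negPf neq_rs) ?(negPf neq_sr) //.
  move=> brs bsr [[w1 [adm1 _] def1] max1] [[w2 [adm2 _] def2] max2].
  split=> [|_ [w adm ->]].
    by case: (leP brs bsr) => _; [exists w2 | exists w1].
  have /andP[/andP[pw /eqP lw] _] := adm.
  (* Any geodesic deletes the required layers in some order, and two layers have only two orders, so
     its capacity is bounded by one of the two maxima. *)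
  have := deleted_layers_required pw lw; rewrite -(permPr hlayers) le_max => /perm_eq2[] dl.
    by rewrite max1 //; exists w.
  by rewrite max2 ?orbT //; exists w.
- move=> eq_rs o; subst s.
  have := count_layers r; rewrite eqxx => gap2.
  (* The hypothesis [hlayers] may list the two levels in either order, so they are recomputed from
     the gap of 2 at [r]. *)
  have top : perm_eq [:: (r, logn r H); (r, (logn r H).-1)] (required_layers H H').
    apply: uniq_perm; rewrite ?required_layers_uniq //= ?inE ?xpair_eqE ?eqxx; first by lia.
    move=> [p j]; rewrite mem_required_layers !inE !xpair_eqE.
    by have := count_layers p; case: (eqVneq r p) => [<-|_] /=; lia.
  split=> [/andP[del_o]|->]; last first.
    by rewrite /admissible_order /deletion_order top /= eqxx; lia.
  have : perm_eq o [:: (r, logn r H); (r, (logn r H).-1)] by rewrite (permPr top).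
  by case/perm_eq2=> -> //=; rewrite eqxx; lia.
Qed.
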